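(* Let $1<p<\infty$ and let $\|\cdot\|_{p,\vec\mu}$ be a discrete Sobolev $p$-norm which is sequentially ordered and is written as $$\|f\|_{p,\vec\mu}=\left(\int_\Delta|f|^p\,d\mu+\sum_{j=1}^N\sum_{k=0}^{m_j}A_{j,k}|f^{(k)}(c_j)|^p\right)^{1/p},$$ where $\mu$ is taken in such a way that $c_j\notin\Delta^{\mathrm o}$ for $j=1,\dots,N$. Let $P_n$ be the $n$-th minimal polynomial with respect to $\|\cdot\|_{p,\vec\mu}$. Then $P_n$ has at least $n-\mathbf d^*$ changes of sign on $\Delta^{\mathrm o}$, where $\mathbf d^*$ is the number of pairs $(j,k)$ with $1\le j\le N$, $0\le k\le m_j$ and $A_{j,k}>0$.
   Context: Setting: $\mu$ is a finite positive Borel measure with $\operatorname{supp}\mu\subset\mathbb{R}$ infinite and all polynomials in $L^1(\mu)$; $\Delta$ is the convex hull of $\operatorname{supp}\mu$ and $\Delta^{\mathrm o}$ its interior; $c_1,\dots,c_N\in\mathbb{R}$ are distinct points; $m_1,\dots,m_N$ are nonnegative integers, $m=\max_j m_j$; $A_{j,k}\ge0$, $A_{j,m_j}>0$ for every $j$, and $A_{j,k}=0$ for $m_j<k\le m$. Write $\mathbf{Co}(A)$ for the convex hull of $A\subset\mathbb{R}$ (with $\mathbf{Co}(\emptyset)=\emptyset$) and $\mathbf{Co}(A)^{\mathrm o}$ for its interior in $\mathbb{R}$. Put $\Delta_0=\mathbf{Co}(\Delta\cup\{c_j:A_{j,0}>0\})$ and $\Delta_k=\mathbf{Co}(\{c_j:A_{j,k}>0\})$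 for $1\le k\le m$. The norm is sequentially ordered if $$\Delta_k\cap\mathbf{Co}\Big(\bigcup_{i=0}^{k-1}\Delta_i\Big)^{\mathrm o}=\emptyset,\qquad k=1,\dots,m .$$ The $n$-th minimal polynomial is the monic polynomial $P_n$ of degree $n$ with $\|P_n\|_{p,\vec\mu}\le\|Q\|_{p,\vec\mu}$ for every monic polynomial $Q$ of degree $n$; it has real coefficients. The changes of sign of $P_n$ on $\Delta^{\mathrm o}$ are the points of $\Delta^{\mathrm o}$ at which $P_n$ changes sign. *)

(* Defs.v *)
From mathcomp Require Import all_boot all_order all_algebra.
From mathcomp Require Import all_classical all_reals all_analysis.

Set Implicit Arguments.
Unset Strict Implicit.
Unset Printing Implicit Defensive.

Import Order.TTheory GRing.Theory Num.Theory.
Import numFieldNormedType.Exports.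

Local Open Scope classical_set_scope.
Local Open Scope ring_scope.

Section definitions.
Context {R : realType}.

Definition Co (A : set R) : set R := smallest (@convex_set R R^o) A.

Definition supp (mu : set (measurableTypeR R) -> \bar R) : set R :=
  [set x | forall U : set R, open U -> U x -> (0 < mu U)%E].

Section sobolev.
Variables (mu : {finite_measure set (measurableTypeR R) -> \bar R}).
Variables (N : nat) (c : 'I_N -> R) (m : 'I_N -> nat).
(* [A j k] is only constrained and used for k <= mmax. *)
Variable A : 'I_N -> nat -> R.

Definition Delta : set R := Co (supp mu).

Definition mmax : nat := \max_(j < N) m j.

Definition Deltak (k : nat) : set R :=
  if k is 0 then Co (Delta `|` [set c j | j in [set j | 0 < A j 0]])
  else Co [set c j | j in [set j | 0 < A j k]].

Definition sequentially_ordered : Prop :=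
  forall k : nat, (1 <= k <= mmax)%N ->
    Deltak k `&` (Co (\bigcup_(i < k) Deltak i))° = set0.

(* The real-valued integral loses nothing here: if all polynomials are
   mu-integrable then so is |f|^p, because |f|^p <= 1 + f^(2r) for r >= p/2. *)
Definition sobolev_norm (p : R) (f : {poly R}) : R :=
  (\int[mu]_(x in Delta) (`|f.[x]| `^ p)
   + \sum_(j < N) \sum_(k < (m j).+1) A j k * `|f^`(k).[c j]| `^ p) `^ p^-1.

(* Competitors with complex coefficients would change nothing: dropping the
   imaginary parts of the coefficients does not increase the norm. *)
Definition minimal_polynomial (p : R) (n : nat) (P : {poly R}) : Prop :=
  [/\ P \is monic, size P = n.+1 &
      forall Q : {poly R}, Q \is monic -> size Q = n.+1 ->
        sobolev_norm p P <= sobolev_norm p Q].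

Definition dstar : nat :=
  #|[pred jk : {j : 'I_N & 'I_(m j).+1} | 0 < A (tag jk) (tagged jk)]|.

End sobolev.

Definition changes_sign_at (P : {poly R}) (x : R) : Prop :=
  exists2 e : R, 0 < e &
    forall y z : R, x - e < y < x -> x < z < x + e -> P.[y] * P.[z] < 0.

End definitions.

(* Main.v *)
(* Suppose that [P] has fewer than [n - dstar] roots of odd multiplicity in the
   interior [J] of [Delta], and let [xs] be these roots.  Among the nonzero
   polynomials that vanish on [xs] and whose [k]-th derivative vanishes at
   [c j] whenever [0 < A j k], let [Q] be one of minimal degree [D].  By
   minimality at least [D] of the conditions concern derivatives of order less
   than [D].  Sequential ordering keeps the nodes of order [k.+1] apart from the
   roots that Rolle's theorem yields at this order, so the count of distinct
   roots, carried from [Q] up to its derivative of degree 1, leaves no room for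
   another root of odd multiplicity in [J], nor for a multiple root at a point
   of [xs]: [P * Q] has constant sign on [Delta].  Up to the sign of [Q],
   [|P - t Q|^p <= |P|^p - t |P|^(p-1) |Q| + 2 t^p |Q|^p], so for small [t > 0]
   the competitor [P - t Q], which has the same discrete part as [P], has a
   smaller norm. *)

Require Import Defs.
From mathcomp Require Import all_boot all_order all_algebra.
From mathcomp Require Import all_classical all_reals all_analysis.
From mathcomp Require Import measurable_realfun cauchyreals polyrcf.
From mathcomp Require Import zify ring lra.

Set Implicit Arguments.
Unset Strict Implicit.
Unset Printing Implicit Defensive.

Import Order.TTheory GRing.Theory Num.Theory.
Import numFieldNormedType.Exports.

Local Open Scope classical_set_scope.
Local Open Scope card_scope.
Local Open Scope ring_scope.

(** * Multiplicities and signs, Rolle's theorem, and the solvability of Birkhoff conditions *)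

Section polynomials.
Context {R : realType}.
Implicit Types (f g h : {poly R}) (x y u v : R).

Lemma mup_factor f x : f != 0 ->
  exists2 g, ~~ root g x & f = g * ('X - x%:P) ^+ mup x f.
Proof.
move=> f0; have [k [g]] := multiplicity_XsubC f x; rewrite f0 /= => gx ->.
by exists g => //; rewrite mupMr// mup_XsubCX eqxx.
Qed.

Lemma odd_mup_root f x : odd (mup x f) -> root f x.
Proof. by apply: contraTT => /mupNroot ->. Qed.

(** A root of even multiplicity of a nonzero polynomial is at least double. *)
Lemma root_deriv_even_mup f x : root f x -> ~~ odd (mup x f) ->
  root f^`() x.
Proof.
have [->|f0] := eqVneq f 0; first by rewrite deriv0 root0.
move=> fx fe; have fk : (0 < mup x f)%N by rewrite -XsubC_dvd// dvdp_XsubCl.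
have [g _ ->] := mup_factor x f0.
case: (mup x f) fk fe => [|[|k]]//= _ _.
rewrite !exprSr !mulrA; set h := g * _.
by rewrite /root !derivM !hornerE subrr !mulr0 mul0r !addr0.
Qed.

(** Continuity of [f * f.[x]%:P], which is positive at [x]. Comparing two nearby points with each
    other fits the form of [changes_sign_at]. *)
Lemma locally_nonzero f x : ~~ root f x ->
  exists2 e : R, 0 < e & forall y z, `|y - x| < e -> `|z - x| < e ->
    0 < f.[y] * f.[z].
Proof.
move=> fx.
have fx0 : 0 < f.[x] * f.[x] by rewrite -expr2 exprn_even_gt0.
have fc : (f * f.[x]%:P).[y] @[y --> x] --> f.[x] * f.[x].
  rewrite [X in _ --> X](_ : _ = (f * f.[x]%:P).[x]).
    exact: continuous_horner.
  by rewrite hornerM hornerC.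
have near_gt0 : nbhs x [set y | 0 < (f * f.[x]%:P).[y]].
  exact: (cvgr_gt _ fc _ fx0).
have [e /= e0 he] := (nbhs_ballP x _).1 near_gt0.
exists e => // y z yx zx.
have := he y; rewrite /ball/= distrC hornerM hornerC => /(_ yx) fy.
have := he z; rewrite /ball/= distrC hornerM hornerC => /(_ zx) fz.
by have := mulr_gt0 fy fz; rewrite mulrACA pmulr_lgt0.
Qed.

Lemma odd_mup_changes_sign f x : f != 0 -> odd (mup x f) -> changes_sign_at f x.
Proof.
move=> f0; have [g gx] := mup_factor x f0; move: (mup x f) => k fE ko.
have [e e0 ge] := locally_nonzero gx.
exists e => // y z /andP[y1 y2] /andP[z1 z2].
rewrite fE !hornerM !horner_exp !hornerXsubC mulrACA -exprMn.
rewrite pmulr_rlt0; last by apply: ge; rewrite ltr_norml; apply/andP; lra.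
by rewrite exprn_odd_lt0// nmulr_rlt0 ?subr_gt0 ?subr_lt0.
Qed.

(** The intermediate value theorem gives a root strictly between [u] and [v]. If its multiplicity is
    even, dividing it out keeps the sign of the product of the values at [u] and [v] and lowers the
    size, hence the induction on size. *)
Lemma odd_mup_between f u v : f.[u] * f.[v] < 0 -> u < v ->
  exists2 x, u < x < v & odd (mup x f).
Proof.
move: {2}(size f) (leqnn (size f)) => k; elim: k f => [|k IH] f.
  by rewrite leqn0 size_poly_eq0 => /eqP ->; rewrite !horner0 mul0r ltxx.
move=> fk fuv uv.
have f0 : f != 0 by apply: contraTneq fuv => ->; rewrite !horner0 mul0r ltxx.
have [x /andP[ux xv] fx] : exists2 x, u < x < v & root f x.
  have := fuv; rewrite -[_ * _ < _]/(f.[u] * f.[v] < 0).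
  have [fu|fu|fu] := ltgtP f.[u] 0; last by rewrite fu mul0r ltxx.
    rewrite nmulr_rlt0// => fv.
    have [|x /andP[ux xv] rx] := @poly_ivt _ f u v (ltW uv).
      by rewrite !ltW.
    exists x => //; rewrite !lt_neqAle ux xv !andbT.
    by apply/andP; split; apply: contraTneq rx;
      [move=> <-|move=> ->]; rewrite /root;
      [rewrite lt_eqF|rewrite gt_eqF].
  rewrite pmulr_rlt0// => fv.
  have [|x /andP[ux xv] rx] := @poly_ivt _ (- f) u v (ltW uv).
    by rewrite !hornerN oppr_le0 oppr_ge0 !ltW.
  rewrite rootN in rx.
  exists x => //; rewrite !lt_neqAle ux xv !andbT.
  by apply/andP; split; apply: contraTneq rx;
    [move=> <-|move=> ->]; rewrite /root;
      [rewrite gt_eqF|rewrite lt_eqF].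
have [g gx] := mup_factor x f0; move muk: (mup x f) => i fE.
have [fo|fe] := boolP (odd i); first by exists x; rewrite ?ux ?muk.
have i0 : (0 < i)%N by rewrite -muk -XsubC_dvd// dvdp_XsubCl.
have g0 : g != 0 by apply: contraNneq gx => ->; rewrite root0.
have Xk0 : ('X - x%:P) ^+ i != 0 by rewrite expf_neq0// polyXsubC_eq0.
have gk : (size g <= k)%N.
  move: fk; rewrite fE size_Mmonic ?monic_exp ?monicXsubC//.
  rewrite size_exp_XsubC addnS/= => h; rewrite -ltnS; apply: leq_trans h.
  by rewrite -addn1 leq_add2l.
have guv : g.[u] * g.[v] < 0.
  move: fuv; rewrite fE !hornerM !horner_exp !hornerXsubC mulrACA -exprMn.
  rewrite pmulr_llt0//.
  rewrite exprn_even_gt0//; apply/orP; right.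
  by rewrite mulf_neq0// subr_eq0 ?(lt_eqF ux) ?(gt_eqF xv).
have [y yuv yo] := IH g gk guv uv; exists y => //.
have xy : x != y by apply: contraNneq gx => ->; exact: odd_mup_root.
by rewrite fE mupM// mup_XsubCX (negbTE xy) addn0.
Qed.

(** The last clause records where the new roots lie: off the old ones, and strictly between two of
    them. Both facts serve later to keep the Rolle roots apart from other roots of the
    derivative. *)
Lemma rolle_path f x (s : seq R) : path <%R x s -> all (root f) (x :: s) ->
  exists t, [/\ size t = size s, path <%R x t, all (root f^`()) t &
   {in t, forall z, z \notin x :: s /\
     exists u v, [/\ u \in x :: s, v \in x :: s & u < z < v]}].
Proof.
elim: s x => [|y s IH] x /=; first by exists [::].
move=> /andP[xy ys] /and3P[fx fy fs].
have [|t [ts yt rt tP]] := IH y ys; first by rewrite /= fy.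
have [|z] := @poly_rolle _ x y f xy; first by rewrite (rootP fx) (rootP fy).
rewrite in_itv/= => /andP[xz zy] fz.
have tgt : {in t, forall w, y < w}.
  by move: yt; rewrite (path_sortedE lt_trans) => /andP[/allP].
have sgt : {in s, forall w, y < w}.
  by move: ys; rewrite (path_sortedE lt_trans) => /andP[/allP].
exists (z :: t); split => /=.
- by rewrite ts.
- rewrite xz /= (path_sortedE lt_trans) (path_sorted yt) andbT.
  by apply/allP => w /tgt; exact: lt_trans.
- by rewrite rt andbT; apply/rootP.
move=> w; rewrite inE => /predU1P[->|wt].
  split; last by exists x, y; rewrite !inE !eqxx orbT xz zy.
  rewrite !inE !negb_or gt_eqF// lt_eqF//=.
  by apply/negP => /sgt /(lt_trans zy); rewrite ltxx.
have [wys [u [v [us vs uwv]]]] := tP w wt; split; last first.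
  by exists u, v; rewrite inE us orbT inE vs orbT.
by rewrite inE negb_or wys andbT gt_eqF// (lt_trans xy)// tgt.
Qed.

Lemma rolle_seq f (s : seq R) : uniq s -> all (root f) s ->
  exists t, [/\ (size s <= (size t).+1)%N, uniq t, all (root f^`()) t &
   {in t, forall z, z \notin s /\
     exists u v, [/\ u \in s, v \in s & u < z < v]}].
Proof.
move=> us fs; have := sort_lt_sorted s; rewrite us.
have sP := mem_sort <=%R s.
move: fs; rewrite -(eq_all_r sP) -(size_sort <=%R s).
case sE: (sort _ s) sP => [|x s'] sP fs; first by exists [::].
move=> /= xs; have [t [ts xt rt tP]] := rolle_path xs fs.
exists t; split => //; first by rewrite /= ts.
  by apply: lt_sorted_uniq; exact: path_sorted xt.
move=> z /tP [zs [u [v [us' vs uzv]]]]; rewrite -sP; split => //.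
by exists u, v; rewrite -!sP.
Qed.

Lemma birkhoff_solution d (cs : seq (R * nat)) : (size cs < d)%N ->
  exists f, [/\ f != 0, (size f <= d)%N & {in cs, forall c, root f^`(c.2) c.1}].
Proof.
move=> csd; pose M : 'M[R]_(d, size cs) :=
  \matrix_(a, b) ('X^a)^`((nth (0, 0%N) cs b).2).[(nth (0, 0%N) cs b).1].
have : kermx M != 0.
  rewrite kermx_eq0 /row_free neq_ltn (leq_ltn_trans _ csd)//.
  exact: rank_leq_col.
move=> /rowV0Pn[r]; rewrite sub_kermx => /eqP rM r0.
exists (rVpoly r); split.
- by apply: contraNneq r0 => r0; rewrite -(rVpolyK r) r0 linear0.
- exact: size_poly.
move=> cnd ccs; have ics : (index cnd cs < size cs)%N by rewrite index_mem.
have := congr1 (fun B : 'rV_ _ => B 0 (Ordinal ics)) rM.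
rewrite !mxE => rMi; apply/rootP; rewrite -[RHS]rMi.
rewrite /rVpoly poly_def raddf_sum/= horner_sum; apply: eq_bigr => a _.
by rewrite mxE /= nth_index// derivnZ hornerZ valK.
Qed.

End polynomials.

(** * Convex hulls on the real line and infinite sets of reals *)

Section convex_hull.
Context {R : realType}.
Implicit Types (E F : set R) (x y u v : R).

Lemma convex_interval E : @convex_set R R^o E -> is_interval E.
Proof.
move=> Ec x y Ex Ey z /andP[xz zy].
have [xy|xy] := eqVneq x y.
  by have -> : z = x by apply/eqP; rewrite eq_le xz [X in _ <= X]xy zy.
have xy0 : 0 < y - x by rewrite subr_gt0 lt_neqAle xy (le_trans xz zy).
(* The weight of [x] when [z] is written as a convex combination of [x] and [y]. *)
pose t := (y - z) / (y - x).
have t0 : 0 <= t by rewrite divr_ge0 ?(ltW xy0)// subr_ge0.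
have t1 : t <= 1 by rewrite ler_pdivrMr// mul1r lerD2l lerN2.
have := Ec x y (Itv01 t0 t1); rewrite !inE => /(_ Ex Ey).
have -> : z = t * x + (1 - t) * y; last exact.
rewrite /t; field.
by rewrite gt_eqF.
Qed.

Lemma sub_Co E : E `<=` Co E.
Proof. exact: sub_gen_smallest. Qed.

Lemma Co_convex E : @convex_set R R^o (Co E).
Proof.
move=> x y l; rewrite !inE => Ex Ey F [Fc EF].
by have := Fc x y l; rewrite !inE; apply; [exact: Ex|exact: Ey].
Qed.

Lemma Co_mono E F : E `<=` F -> Co E `<=` Co F.
Proof.
move=> EF; apply: smallest_sub; first exact: Co_convex.
exact: subset_trans EF (@sub_Co F).
Qed.

Lemma Co_interval E : is_interval (Co E).
Proof. exact: convex_interval (@Co_convex E). Qed.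

Lemma interval_interior E x u v : is_interval E -> E u -> E v -> u < x < v ->
  E° x.
Proof.
move=> Ei Eu Ev uxv; have xuv : x \in `]u, v[ by rewrite in_itv.
apply: filterS (near_in_itvoo xuv) => y; rewrite in_itv/= => /andP[uy yv].
by apply: (Ei u v) => //; rewrite !ltW.
Qed.

(** Used to find a point of [E] that is interior to every interval containing [E]: the middle one of
    the three. *)
Lemma infinite_strict_triple E : infinite_set E ->
  exists x y z, [/\ E x, E y, E z & x < y < z].
Proof.
move=> /(infinite_set_fset 3) [B BE B3].
have := sort_lt_sorted (finmap.enum_fset B); rewrite finmap.fset_uniq.
have := mem_sort <=%R (finmap.enum_fset B).
have := size_sort <=%R (finmap.enum_fset B).
case: (sort _ _) => [|x [|y [|z s]]] sB mB; rewrite -?sB// in B3 => /=.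
move=> /and3P[xy yz _]; exists x, y, z; rewrite xy yz.
by split => //; apply: BE => /=; rewrite -mB !inE eqxx ?orbT.
Qed.

Lemma finite_roots (f : {poly R}) : f != 0 -> finite_set [set x | root f x].
Proof.
move=> f0; apply: contrapT => /(infinite_set_fset (size f)) [B Bf].
apply/negP; rewrite -ltnNge; apply: max_poly_roots => //.
  by apply/allP => x xB; exact: Bf.
exact: finmap.fset_uniq.
Qed.

End convex_hull.

(** * Integrability of powers and decrease of the integral along a direction of equal sign *)

Section integrals.
Context {R : realType}.
Variable mu : {finite_measure set (measurableTypeR R) -> \bar R}.
Hypothesis poly_integrable : forall f : {poly R},
  mu.-integrable setT (fun x => (f.[x])%:E).
Variable p : R.
Hypothesis p_gt1 : 1 < p.
Implicit Types (f g : {poly R}) (D : set (measurableTypeR R)).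

Let p_gt0 : 0 < p. Proof. exact: lt_trans p_gt1. Qed.

Lemma powR_norm_sub_le (a h : R) : 0 <= a -> 0 <= h ->
  `|a - h| `^ p <= a `^ p - a `^ (p - 1) * h + 2 * h `^ p.
Proof.
move=> a0 h0; have p10 : 0 <= p - 1 by rewrite subr_ge0 ltW.
have hp0 := powR_ge0 h p; have ap0 := powR_ge0 a p.
have [ha|ah] := leP h a.
  rewrite ger0_norm ?subr_ge0// -mulr_powRB1 ?subr_ge0//.
  have lea : (a - h) * (a - h) `^ (p - 1) <= (a - h) * a `^ (p - 1).
    rewrite ler_wpM2l ?subr_ge0// ge0_ler_powR// ?nnegrE ?subr_ge0//.
    by rewrite gerBl.
  apply: le_trans lea _; rewrite mulrBl mulr_powRB1// [h * _]mulrC; lra.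
have : `|a - h| `^ p <= h `^ p.
  apply: ge0_ler_powR; rewrite ?nnegrE ?(ltW p_gt0)// ler_norml; lra.
have : a `^ (p - 1) * h <= h `^ p.
  rewrite -[leRHS]mulr_powRB1// mulrC ler_wpM2l// ge0_ler_powR ?nnegrE//.
  exact: ltW.
lra.
Qed.

Lemma powR_horner_sub_le f g (t x : R) : 0 <= t -> 0 <= f.[x] * g.[x] ->
  `|(f - t *: g).[x]| `^ p <= `|f.[x]| `^ p
    + (- t * (`|f.[x]| `^ (p - 1) * `|g.[x]|) + 2 * t `^ p * `|g.[x]| `^ p).
Proof.
(* Since the two values do not have opposite signs, the subtraction takes place between absolute
   values. *)
move=> t0 fg0; have -> : `|(f - t *: g).[x]| = `| `|f.[x]| - t * `|g.[x]| |.
  rewrite !hornerE; have [g0|g0] := leP 0 g.[x].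
    have [f0|f0] := leP 0 f.[x].
      by rewrite (ger0_norm f0) (ger0_norm g0).
    have -> : g.[x] = 0.
      by apply/eqP; rewrite eq_le g0 andbT; rewrite nmulr_rge0 in fg0.
    by rewrite normr0 !mulr0 !subr0 normr_id.
  have f0 : f.[x] <= 0 by rewrite nmulr_lge0 in fg0.
  by rewrite (ler0_norm f0) (ltr0_norm g0) mulrN -opprD normrN.
apply: (le_trans (powR_norm_sub_le _ _)); rewrite ?mulr_ge0// powRM//.
by rewrite le_eqVlt; apply/orP; left; apply/eqP; ring.
Qed.

Lemma measurable_powR_norm_horner D f (q : R) :
  measurable_fun D (fun x => `|f.[x]| `^ q).
Proof.
apply: (measurableT_comp (measurable_powR q)).
apply: (measurableT_comp (@normr_measurable R setT)); exact: measurable_poly.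
Qed.

(** Supplies a polynomial majorant of [|f|^p], so that integrability reduces to that of
    polynomials. *)
Lemma powR_norm_le_even (y : R) k : p <= k.*2%:R -> `|y| `^ p <= 1 + y ^+ k.*2.
Proof.
move=> pk; have [y1|y1] := leP `|y| 1.
  apply: (@le_trans _ _ (1 `^ p)).
    by apply: ge0_ler_powR; rewrite ?nnegrE ?(ltW p_gt0).
  by rewrite powR1 lerDl exprn_even_ge0// odd_double.
apply: (@le_trans _ _ (`|y| `^ k.*2%:R)); first by rewrite ler_powR// ltW.
rewrite powR_mulrn// -normrX ger0_norm ?lerDr//.
by rewrite exprn_even_ge0// odd_double.
Qed.

Lemma integrable_powR_norm_horner D f : measurable D ->
  mu.-integrable D (EFin \o (fun x => `|f.[x]| `^ p)).
Proof.
move=> mD; have [k pk] : exists k : nat, p <= (k.*2)%:R.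
  exists (Num.truncn p).+1; rewrite -addnn natrD.
  by have := truncnS_gt p; have : 0 <= ((Num.truncn p).+1%:R : R) by []; lra.
apply: (@le_integrable _ _ _ mu D mD _ (fun x => ((1 + f ^+ k.*2).[x])%:E)).
- by apply/measurable_EFinP; exact: measurable_powR_norm_horner.
- move=> x _; rewrite lee_fin /= (ger0_norm (powR_ge0 _ _)).
  by rewrite (le_trans (powR_norm_le_even _ pk))// !hornerE ler_norm.
- exact: integrableS (poly_integrable _).
Qed.

Lemma integrable_powR_norm_horner_mul D f g : measurable D ->
  mu.-integrable D (EFin \o (fun x => `|f.[x]| `^ (p - 1) * `|g.[x]|)).
Proof.
move=> mD; have p10 : 0 <= p - 1 by rewrite subr_ge0 ltW.
apply: (@le_integrable _ _ _ mu D mD _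
  (EFin \o (fun x => `|f.[x]| `^ p + `|g.[x]| `^ p))).
- apply/measurable_EFinP; apply: measurable_funM.
    exact: measurable_powR_norm_horner.
  apply: (measurableT_comp (@normr_measurable R setT)).
  exact: measurable_poly.
- move=> x _; rewrite lee_fin /=.
  rewrite (ger0_norm (mulr_ge0 (powR_ge0 _ _) (normr_ge0 _))).
  rewrite (ger0_norm (addr_ge0 (powR_ge0 _ _) (powR_ge0 _ _))).
  have [fg|gf] := leP `|f.[x]| `|g.[x]|.
    rewrite (le_trans (y := `|g.[x]| `^ p)) ?lerDr ?powR_ge0//.
    by rewrite -[leRHS]mulr_powRB1// mulrC ler_wpM2l// ge0_ler_powR ?nnegrE.
  rewrite (le_trans (y := `|f.[x]| `^ p)) ?lerDl ?powR_ge0//.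
  by rewrite -[leRHS]mulr_powRB1// mulrC ler_wpM2r ?powR_ge0// ltW.
- have := integrableD mD (integrable_powR_norm_horner f mD)
    (integrable_powR_norm_horner g mD).
  by apply: eq_integrable => // x _; rewrite /= EFinD.
Qed.

(** A zero integral would make the integrand vanish almost everywhere on [D]. But off the finitely
    many roots of [f * g] there remains a support point interior to [D], and the open set of
    interior non-roots around it has positive measure. *)
Lemma Rintegral_powR_horner_gt0 D f g : measurable D -> is_interval D ->
  infinite_set (supp mu `&` D) -> f * g != 0 ->
  0 < \int[mu]_(x in D) (`|f.[x]| `^ (p - 1) * `|g.[x]|).
Proof.
move=> mD Di suppD fg0.
have intfg := integrable_powR_norm_horner_mul f g mD.
rewrite lt0r Rintegral_ge0 ?andbT; last first.
  by move=> x _; rewrite mulr_ge0 ?powR_ge0.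
apply/eqP => int0.
have : infinite_set ((supp mu `&` D) `\` [set x | root (f * g) x]).
  exact: infinite_setD suppD (finite_roots fg0).
move=> /infinite_strict_triple.
move=> [a [b [c [[[_ Da] _] [[sb _] fgb] [[_ Dc] _] abc]]]].
pose U : set R := D° `&` [set x | (f * g).[x] != 0].
have Uo : open U.
  apply: openI; first exact: open_interior.
  apply: (@open_comp _ _ (horner (f * g)) [set y : R | y != 0]).
    by move=> x _; exact: continuous_horner.
  exact: open_neq.
have Ub : U b.
  split; first exact: (interval_interior Di Da Dc).
  exact/negP.
have := sb U Uo Ub; apply/negP; rewrite -leNgt.
have : ae_eq mu D (EFin \o (fun x => `|f.[x]| `^ (p - 1) * `|g.[x]|)) (cst 0%E).
  apply/ae_eq_integral_abs => //.
    by apply: measurable_int intfg.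
  transitivity (\int[mu]_(x in D) (`|f.[x]| `^ (p - 1) * `|g.[x]|)%:E)%E.
    by apply: eq_integral => x _; rewrite /= ger0_norm// mulr_ge0// powR_ge0.
  by rewrite -[LHS]fineK ?integrable_fin_num//; congr EFin.
move=> [Z [mZ Z0 DZ]].
rewrite -Z0; apply: le_measure; rewrite ?inE//; first exact: open_measurable.
move=> x [Dx fgx]; apply: DZ => /= /(_ (interior_subset Dx)) [] /eqP.
rewrite mulf_eq0 powR_eq0 !normr_eq0 => h.
move: fgx; rewrite /= hornerM mulf_eq0.
by case/orP: h => [/andP[->]|->]; rewrite ?orbT.
Qed.

Lemma Rintegral_powR_descent D f g : measurable D ->
  (forall x, D x -> 0 <= f.[x] * g.[x]) ->
  0 < \int[mu]_(x in D) (`|f.[x]| `^ (p - 1) * `|g.[x]|) ->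
  exists2 t : R, 0 < t &
    \int[mu]_(x in D) (`|(f - t *: g).[x]| `^ p) <
    \int[mu]_(x in D) (`|f.[x]| `^ p).
Proof.
move=> mD fg0; set a := (X in 0 < X) => a0.
pose b := \int[mu]_(x in D) (`|g.[x]| `^ p).
have b0 : 0 <= b by apply: Rintegral_ge0 => x _; exact: powR_ge0.
have p10 : 0 < p - 1 by rewrite subr_gt0.
(* The upper bound for the change of the integral is [t * (2 * t]^ (p - 1) * b -
   a)[. Choosing]t[with]t [^ (p - 1) = s] makes it negative, and the summand 1 covers the case
   [b = 0]. *)
pose s := a / (2 * b + 1); have s0 : 0 < s by rewrite divr_gt0//; lra.
pose t := s `^ (p - 1)^-1; have t0 : 0 < t by exact: powR_gt0.
have ts : t `^ (p - 1) = s.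
  by rewrite /t -powRrM mulVf ?gt_eqF// powRr1// ltW.
exists t => //.
have i1 := integrable_powR_norm_horner f mD.
have i2 := integrable_powR_norm_horner_mul f g mD.
have i3 := integrable_powR_norm_horner g mD.
have iZ q (u : R -> R) : mu.-integrable D (EFin \o u) ->
    mu.-integrable D (EFin \o (fun x => q * u x)).
  by move=> iu; exact: (integrableZl mD q iu).
have iD (u v : R -> R) : mu.-integrable D (EFin \o u) ->
    mu.-integrable D (EFin \o v) ->
    mu.-integrable D (EFin \o (fun x => u x + v x)).
  by move=> iu iv; exact: (integrableD mD iu iv).
apply: (@le_lt_trans _ _ (\int[mu]_(x in D) (`|f.[x]| `^ p
    + (- t * (`|f.[x]| `^ (p - 1) * `|g.[x]|) + 2 * t `^ p * `|g.[x]| `^ p)))).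
  apply: le_Rintegral => //; first exact: integrable_powR_norm_horner.
    by apply: (iD) => //; apply: (iD); exact: (iZ).
  by move=> x Dx; apply: powR_horner_sub_le; [exact: ltW|exact: fg0].
rewrite RintegralD//; last by apply: (iD); exact: (iZ).
rewrite RintegralD//; [|exact: (iZ)|exact: (iZ)].
rewrite !RintegralZl// -/a -/b gtrDl -mulr_powRB1 ?(ltW t0)// ts.
rewrite [X in X < 0](_ : _ = t * (2 * s * b - a)); last by ring.
rewrite pmulr_rlt0// subr_lt0 /s -mulrA mulrCA -mulrA gtr_pMr//.
rewrite mulrC ltr_pdivrMr ?mul1r; lra.
Qed.

End integrals.

(** * Counting roots of successive derivatives under Birkhoff conditions *)

Section birkhoff.
Context {R : realType}.
Implicit Types (f : {poly R}) (x y : R).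

Let size_derivnR f k : size f^`(k) = (size f - k)%N.
Proof. exact: size_derivn. Qed.

Lemma rolle_interval (E : set R) f (s : seq R) : is_interval E ->
  uniq s -> all (root f) s -> {in s, forall x, E x} ->
  exists t, [/\ (size s <= (size t).+1)%N, uniq t, all (root f^`()) t,
    {in t, forall x, E° x} & {in t, forall x, x \notin s}].
Proof.
move=> Ei us fs Es; have [t [st ut ft tP]] := rolle_seq us fs.
exists t; split => // x /tP[]// _ [u [v [us' vs uxv]]].
exact: (interval_interior Ei (Es _ us') (Es _ vs)).
Qed.

(* In the application [I k] is the convex hull of Delta_0, ..., Delta_k and
   [C k] lists the [c j] with [0 < A j k]. *)
Variables (I : nat -> set R) (C : nat -> seq R).
Hypotheses (I_interval : forall k, is_interval (I k))
  (I_mono : forall k, I k `<=` I k.+1)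
  (C_uniq : forall k, uniq (C k))
  (C_sub : forall k, {in C k, forall x, I k x})
  (C_out : forall k, {in C k.+1, forall x, ~ (I k)° x}).

(** Each differentiation costs at most one root by Rolle and gains the nodes of the new order. The
    two kinds are disjoint: Rolle roots lie in the interior of the current interval, which [C_out]
    forbids to the new nodes. *)
Lemma birkhoff_root_count f (k0 k : nat) (s : seq R) :
    (forall i, {in C i, forall x, root f^`(i) x}) ->
    uniq s -> all (root f^`(k0)) s -> {in s, forall x, I k0 x} ->
  exists t, [/\ uniq t, all (root f^`(k0 + k)) t,
    {in t, forall x, I (k0 + k) x} &
    (size s + \sum_(k0.+1 <= i < (k0 + k).+1) size (C i) <= size t + k)%N].
Proof.
move=> fC us fs Is; elim: k => [|k [t [ut ft It szt]]].
  by exists s; rewrite addn0 big_geq// !addn0.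
have [t' [tt' ut' ft' It' _]] :=
  rolle_interval (@I_interval (k0 + k)%N) ut ft It.
exists (t' ++ C (k0 + k).+1); rewrite addnS; split.
- rewrite cat_uniq ut' C_uniq andbT/=; apply/hasPn => x xC.
  by apply/negP => /It'; exact: C_out xC.
- by rewrite all_cat derivnS ft'; apply/allP => x /fC; rewrite derivnS.
- move=> x; rewrite mem_cat => /orP[/It' h|]; last exact: C_sub.
  exact: I_mono (interior_subset h).
- rewrite big_nat_recr/=; last by rewrite ltnS leq_addr.
  move: tt' szt; rewrite size_cat.
  by move: (\sum_(_ <= _ < _) _)%N (size t) (size t') (size (C _)); lia.
Qed.

Lemma birkhoff_degree_bound f (k0 : nat) (s : seq R) :
    (forall i, {in C i, forall x, root f^`(i) x}) ->
    uniq s -> all (root f^`(k0)) s -> {in s, forall x, I k0 x} ->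
    (k0.+1 < size f)%N ->
  (size s + k0 + \sum_(k0.+1 <= i < (size f).-1) size (C i) <= (size f).-1)%N.
Proof.
(* [k] is chosen so that the derivative of order [k0 + k] has degree 1, hence at most one root. *)
move=> fC us fs Is k0f; pose k := ((size f).-2 - k0)%N.
have kE : (k0 + k = (size f).-2)%N by rewrite /k; lia.
have [t [ut ft _]] := birkhoff_root_count k fC us fs Is.
have -> : (k0 + k).+1 = (size f).-1 by lia.
have g0 : f^`(k0 + k) != 0 by rewrite -size_poly_gt0 size_derivnR; lia.
have := max_poly_roots g0 ft ut; rewrite size_derivnR.
by move: (\sum_(_ <= _ < _) _)%N (size t) (size s); lia.
Qed.

Variables (J : set R) (xs : seq R) (n : nat).
Hypotheses (J_sub : J `<=` (I 0)°) (C0_out : {in C 0, forall x, ~ J x})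
  (xs_uniq : uniq xs) (xs_sub : {in xs, forall x, J x})
  (conditions_lt : (size xs + \sum_(0 <= k < n) size (C k) < n)%N).

Lemma birkhoff_sign_polynomial : exists f, [/\ f != 0, (size f <= n)%N,
   forall k, {in C k, forall x, root f^`(k) x} &
   forall y, J y -> odd (mup y f) = (y \in xs)].
Proof.
pose sol f := [/\ f != 0, all (root f) xs &
  forall k, {in C k, forall x, root f^`(k) x}].
(* Only conditions of order below [d] need to be imposed: a polynomial of size at most [d] has zero
   derivatives from order [d] on. *)
have sol_lt d : (size xs + \sum_(0 <= k < d) size (C k) < d)%N ->
    exists2 f, sol f & (size f <= d)%N.
  move=> ltd; pose cs := [seq (x, 0%N) | x <- xs] ++
    [seq (x, k) | k <- iota 0 d, x <- C k].
  have [|f [f0 fd fcs]] := @birkhoff_solution R d cs.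
    rewrite size_cat size_map size_allpairs_dep sumnE big_map.
    by move: ltd; rewrite /index_iota subn0.
  exists f => //; split => //.
    apply/allP => x xxs; apply: (fcs (x, 0%N)).
    by rewrite mem_cat; apply/orP; left; apply/mapP; exists x.
  move=> k x xC; have [kd|dk] := ltnP k d.
    apply: (fcs (x, k)); rewrite mem_cat; apply/orP; right.
    by apply/allpairsPdep; exists k, x; rewrite mem_iota.
  suff -> : f^`(k) = 0 by rewrite root0.
  by apply/eqP; rewrite -size_poly_leq0 size_derivnR; lia.
pose solsize d := `[< exists2 f, sol f & (size f <= d)%N >].
have [|d /asboolP[f [f0 fxs fC] fd] dmin] := @ex_minnP solsize.
  by exists n; apply/asboolP; exact: sol_lt.
have dE : d = size f.
  by apply/eqP; rewrite eqn_leq fd andbT; apply: dmin; apply/asboolP; exists f.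
have f_gt0 : (0 < size f)%N by rewrite size_poly_gt0.
(* With fewer conditions than this, [sol_lt] would yield a solution of smaller degree. *)
have count : ((size f).-1 <=
    size xs + \sum_(0 <= k < (size f).-1) size (C k))%N.
  rewrite leqNgt; apply/negP => /sol_lt[g sg gd].
  have : (d <= (size f).-1)%N by apply: dmin; apply/asboolP; exists g.
  by rewrite dE; lia.
have xsI : {in xs, forall x, I 0 x}.
  by move=> x /xs_sub Jx; exact: interior_subset (J_sub Jx).
have s0_uniq : uniq (xs ++ C 0).
  rewrite cat_uniq xs_uniq C_uniq andbT; apply/hasPn => x /C0_out xJ.
  by apply/negP => /xs_sub.
have s0_root : all (root f) (xs ++ C 0).
  by rewrite all_cat fxs; apply/allP => x /fC.
have s0_sub : {in xs ++ C 0, forall x, I 0 x}.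
  by move=> x; rewrite mem_cat => /orP[/xsI|/C_sub].
exists f; split => //.
  by rewrite -dE; apply: dmin; apply/asboolP; exact: sol_lt.
move=> y Jy; apply/idP/idP => [fy|yxs].
  have ry := odd_mup_root fy.
  have f_gt1 : (1 < size f)%N := root_size_gt1 f0 ry.
  (* A further root [y] in [J] is distinct from [xs] and from the nodes of order 0, so the degree
     bound started at order 0 exceeds [count] by one. *)
  apply: contraT => yxs.
  have s_uniq : uniq (y :: xs ++ C 0).
    rewrite /= s0_uniq mem_cat negb_or yxs andbT/=.
    by apply/negP => /C0_out.
  have s_root : all (root f) (y :: xs ++ C 0) by rewrite /= ry.
  have s_sub : {in y :: xs ++ C 0, forall x, I 0 x}.
    move=> x; rewrite inE => /predU1P[->|/s0_sub//].
    exact: interior_subset (J_sub Jy).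
  have := @birkhoff_degree_bound f 0 _ fC s_uniq s_root s_sub f_gt1.
  move: count; rewrite (@big_ltn _ _ _ 0) /= ?size_cat; last first.
    by rewrite -subn1 subn_gt0.
  by move: (\sum_(_ <= _ < _) _)%N; clear; lia.
apply: contraT => fy.
(* An even root [y] in [xs] is also a root of the derivative, and it is not a Rolle root because
   those avoid [xs ++ C 0]. The count restarted at order 1 then has one root too many. *)
have ry : root f y by move/allP: fxs => /(_ y yxs).
have dy := root_deriv_even_mup ry fy.
have f_gt1 : (1 < size f)%N := root_size_gt1 f0 ry.
have df0 : f^`() != 0 by rewrite -size_poly_gt0 -derivn1 size_derivnR subn_gt0.
have f_gt2 : (2 < size f)%N.
  by have := root_size_gt1 df0 dy; rewrite -derivn1 size_derivnR ltn_subRL.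
have [t [st ut ft It ts]] :=
  rolle_interval (@I_interval 0%N) s0_uniq s0_root s0_sub.
have s_uniq : uniq (y :: t ++ C 1).
  rewrite /= cat_uniq ut C_uniq mem_cat negb_or /= andbT -andbA.
  apply/and3P; split.
  - by apply: contraL yxs => /ts; rewrite mem_cat negb_or => /andP[].
  - by apply/negP => /C_out; apply; exact: J_sub.
  - by apply/hasPn => x xC; apply/negP => /It; exact: C_out xC.
have s_root : all (root f^`(1)) (y :: t ++ C 1).
  by rewrite derivn1 /= all_cat dy ft; apply/allP => x /fC; rewrite derivn1.
have s_sub : {in y :: t ++ C 1, forall x, I 1 x}.
  move=> x; rewrite inE mem_cat => /or3P[/eqP->|/It h|/C_sub//].
    exact: I_mono (interior_subset (J_sub Jy)).
  exact: I_mono (interior_subset h).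
have := @birkhoff_degree_bound f 1 _ fC s_uniq s_root s_sub f_gt2.
move: count st; rewrite (@big_ltn _ _ _ 0); last by rewrite -subn1 subn_gt0.
rewrite (@big_ltn _ _ _ 1) /= ?size_cat; last by rewrite -subn1 ltn_subRL.
by move: (\sum_(_ <= _ < _) _)%N; clear; lia.
Qed.

End birkhoff.

(** * Variation of the minimal polynomial and the number of active conditions *)

Section minimality.
Context {R : realType}.
Variable mu : {finite_measure set (measurableTypeR R) -> \bar R}.
Variables (N : nat) (c : 'I_N -> R) (m : 'I_N -> nat) (A : 'I_N -> nat -> R).
Hypothesis A_ge0 : forall (j : 'I_N) (k : nat), (k <= mmax m)%N -> 0 <= A j k.

Lemma leq_mmax j : (m j <= mmax m)%N.
Proof. exact: (leq_bigmax j). Qed.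

(** As [Q] has degree below [n] and meets every active condition, [P - t *: Q] is a monic competitor
    with the same discrete part; comparing norms therefore compares the integrals. *)
Lemma minimal_polynomial_Rintegral_le (p : R) n (P Q : {poly R}) (t : R) :
    0 < p -> minimal_polynomial mu c m A p n P -> (size Q <= n)%N ->
    (forall j k, (k <= m j)%N -> 0 < A j k -> Q^`(k).[c j] = 0) ->
  \int[mu]_(x in Delta mu) (`|P.[x]| `^ p) <=
  \int[mu]_(x in Delta mu) (`|(P - t *: Q).[x]| `^ p).
Proof.
move=> p0 [Pmonic sP Pmin] sQ Q0.
have sQP : (size (- (t *: Q)) < size P)%N.
  by rewrite size_polyN sP ltnS (leq_trans (size_scale_leq _ _)).
have PQmonic : P - t *: Q \is monic.
  by rewrite monicE lead_coefDl// -monicE.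
have := Pmin _ PQmonic; rewrite size_polyDl// => /(_ sP).
apply: contraTT; rewrite -!ltNge /sobolev_norm => ltPQ.
have -> : \sum_(j < N) \sum_(k < (m j).+1)
      A j k * `|(P - t *: Q)^`(k).[c j]| `^ p =
    \sum_(j < N) \sum_(k < (m j).+1) A j k * `|P^`(k).[c j]| `^ p.
  apply: eq_bigr => j _; apply: eq_bigr => k _.
  have kj : (k <= m j)%N by rewrite -ltnS.
  have : 0 <= A j k by apply: A_ge0; exact: leq_trans kj (leq_mmax j).
  rewrite le_eqVlt => /predU1P[<-|Ajk]; first by rewrite !mul0r.
  by rewrite derivnB derivnZ !hornerE Q0// mulr0 subr0.
have int_ge0 (f : {poly R}) : 0 <= \int[mu]_(x in Delta mu) (`|f.[x]| `^ p).
  by apply: Rintegral_ge0 => x _; exact: powR_ge0.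
have sum_ge0 :
    0 <= \sum_(j < N) \sum_(k < (m j).+1) A j k * `|P^`(k).[c j]| `^ p.
  apply: sumr_ge0 => j _; apply: sumr_ge0 => k _; rewrite mulr_ge0 ?powR_ge0//.
  by apply: A_ge0; rewrite (leq_trans _ (leq_mmax j))// -ltnS.
apply: gt0_ltr_powR; rewrite ?invr_gt0 ?nnegrE ?addr_ge0//.
by rewrite ltrD2r.
Qed.

(** The bound [k <= m j] belongs to the filter because [A j k] is unconstrained beyond [mmax] and
    sequential ordering is silent there. *)
Definition active_nodes k : seq R :=
  [seq c j | j <- enum [pred j | (k <= m j)%N && (0 < A j k)]].

Lemma active_nodesP k x : reflect
  (exists j, [/\ (k <= m j)%N, 0 < A j k & x = c j]) (x \in active_nodes k).
Proof.
apply: (iffP mapP) => [[j]|[j [kj Ajk ->]]].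
  by rewrite mem_enum => /andP[kj Ajk] ->; exists j.
by exists j => //; rewrite mem_enum; apply/andP.
Qed.

(** Exchange the two sums and compare for each [j]. Equality may fail, since active pairs of order
    at least [n] are left out on the left. *)
Lemma sum_active_nodes_le_dstar n :
  (\sum_(0 <= k < n) size (active_nodes k) <= dstar m A)%N.
Proof.
rewrite /dstar -sum1_card.
rewrite -(@sig_big_dep _ _ _ _ (fun j => 'I_(m j).+1) predT
  (fun j k => 0 < A j k) (fun _ _ => 1%N))/=.
under eq_bigr do rewrite size_map -cardE -sum1_card.
rewrite (exchange_big_dep predT)//=; apply: leq_sum => j _.
rewrite -(big_mkord (fun k => 0 < A j k) (fun=> 1%N)).
rewrite -[leqLHS]big_filter -[leqRHS]big_filter !sum1_size.
apply: uniq_leq_size.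
  by rewrite filter_uniq// iota_uniq.
move=> k; rewrite !mem_filter inE /= !mem_index_iota ltnS.
by move=> /andP[/andP[-> ->]].
Qed.

End minimality.

(** * Combination of the sign polynomial with the descent of the integral *)

Theorem theorem4p2 (R : realType)
    (mu : {finite_measure set (measurableTypeR R) -> \bar R})
    (supp_infinite : infinite_set (supp mu))
    (poly_integrable : forall f : {poly R},
       mu.-integrable setT (fun x => (f.[x])%:E))
    (N : nat) (c : 'I_N -> R) (c_inj : injective c)
    (m : 'I_N -> nat) (A : 'I_N -> nat -> R)
    (A_ge0 : forall (j : 'I_N) (k : nat), (k <= mmax m)%N -> 0 <= A j k)
    (A_gt0 : forall j : 'I_N, 0 < A j (m j))
    (A_eq0 : forall (j : 'I_N) (k : nat), (m j < k <= mmax m)%N -> A j k = 0)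
    (p : R) (p_gt1 : 1 < p)
    (ordered : sequentially_ordered mu c m A)
    (c_notin : forall j : 'I_N, ~ (Delta mu)° (c j))
    (n : nat) (P : {poly R}) (P_min : minimal_polynomial mu c m A p n P) :
  `I_(n - dstar m A) #<=
    [set x : R | (Delta mu)° x /\ changes_sign_at P x].
Proof.
have [Pmonic sP _] := P_min.
have P0 : P != 0 by exact: monic_neq0.
pose J := (Delta mu)°.
have Delta_interval : is_interval (Delta mu) by exact: Co_interval.
have [s sE] : exists s : seq R, [set x | J x /\ odd (mup x P)] = [set` s].
  apply/finite_seqP; apply: sub_finite_set (finite_roots P0) => x [_].
  exact: odd_mup_root.
pose xs := undup s.
have xsP x : (x \in xs) <-> J x /\ odd (mup x P).
  by rewrite mem_undup -[_ /\ _]/([set x | J x /\ odd (mup x P)] x) sE.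
have [n_le|n_gt] := leqP (n - dstar m A) (size xs).
  have xs_sub : [set` xs] `<=` [set x | J x /\ changes_sign_at P x].
    by move=> x /= /xsP[Jx Px]; split=> //; exact: odd_mup_changes_sign.
  apply: card_le_trans (subset_card_le xs_sub).
  (* Positions in the duplicate-free list [xs] map it onto an initial segment of the naturals of
     length [size xs]. *)
  apply: card_le_trans (card_image_le (index^~ xs) [set` xs]).
  apply: subset_card_le => i /= i_lt.
  have i_xs : (i < size xs)%N := leq_trans i_lt n_le.
  exists (nth 0 xs i); first exact: mem_nth.
  by rewrite index_uniq// undup_uniq.
(* The union runs up to [k] inclusive, so that [I k] is the hull appearing in the ordering condition
   at [k.+1]. *)
pose I k := Co (\bigcup_(i < k.+1) Deltak mu c A i).
have Delta_I i k : (i <= k)%N -> Deltak mu c A i `<=` I k.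
  by move=> ik x Dx; apply: sub_Co; exists i.
have node_Deltak k j : 0 < A j k -> Deltak mu c A k (c j).
  case: k => [|k] Ajk; apply: sub_Co; [right|]; exists j => //.
have [||||||||||Q [Q0 sQ QC QJ]] :=
  @birkhoff_sign_polynomial R I (active_nodes c m A) _ _ _ _ _ J xs n.
- by move=> k; exact: Co_interval.
- move=> k; apply: Co_mono => x [i ik Dx]; exists i => //=.
  exact: ltnW.
- by move=> k; rewrite map_inj_uniq// enum_uniq.
- move=> k x /active_nodesP[j [_ Ajk ->]].
  exact: Delta_I (node_Deltak _ _ Ajk).
(* This is where sequential ordering enters. *)
- move=> k x /active_nodesP[j [kj Ajk ->]] Ij.
  have := ordered k.+1; rewrite (leq_trans kj (leq_mmax m j)) => /(_ isT).
  by move=> /seteqP[+ _] => /(_ (c j)); apply; split => //; exact: node_Deltak.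
- apply: interiorS => x Dx; apply: (Delta_I 0%N) => //.
  by apply: sub_Co; left.
- by move=> x /active_nodesP[j [_ _ ->]]; exact: c_notin.
- exact: undup_uniq.
- by move=> x /xsP[].
- have sum_le := sum_active_nodes_le_dstar c m A n.
  apply: leq_ltn_trans (leq_add (leqnn _) sum_le) _.
  by rewrite addnC -ltn_subRL.
have PQ0 : P * Q != 0 by rewrite mulf_neq0.
(* On [J] the odd multiplicities of [P] and of [Q] occur at the same points, so those of the product
   are even. *)
have PQ_even y : J y -> ~~ odd (mup y (P * Q)).
  move=> Jy; rewrite mupM// oddD QJ//; case: (boolP (y \in xs)).
    by move=> /xsP[_ ->].
  by move=> yxs; rewrite addbF; apply: contra yxs => Py; apply/xsP.
have [a [b [d [[sa _] [sb PQb] [sd _] abd]]]] :=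
  infinite_strict_triple (infinite_setD supp_infinite (finite_roots PQ0)).
have Db : Delta mu b by exact: sub_Co.
(* Opposite signs at [x] and [b] would force a root of odd multiplicity strictly between two points
   of [Delta mu], hence in [J]. *)
have PQ_sign x : Delta mu x -> 0 <= (P * Q).[x] * (P * Q).[b].
  move=> Dx; rewrite leNgt; apply/negP => PQxb.
  have [xb|bx|xb] := ltgtP x b.
  - have [y xyb] := odd_mup_between PQxb xb.
    exact/negP/PQ_even/(interval_interior Delta_interval Dx Db).
  - rewrite mulrC in PQxb; have [y xyb] := odd_mup_between PQxb bx.
    exact/negP/PQ_even/(interval_interior Delta_interval Db Dx).
  - by move: PQxb; rewrite xb -expr2 ltNge sqr_ge0.
(* Scaling by the nonzero value at [b] fixes the sign: [P * Q'] is nonnegative on [Delta mu]. *)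
pose Q' := (P * Q).[b] *: Q.
have Q'0 : P * Q' != 0.
  by rewrite /Q' -scalerAr scaler_eq0 negb_or PQ0 andbT; exact/negP.
have mDelta : measurable (Delta mu : set (measurableTypeR R)).
  exact: is_interval_measurable.
have [||t t0] := @Rintegral_powR_descent R mu poly_integrable p p_gt1
  (Delta mu) P Q' mDelta.
- move=> x Dx; rewrite -hornerM /Q' -scalerAr hornerZ mulrC; exact: PQ_sign.
- apply: Rintegral_powR_horner_gt0 => //.
  rewrite setIidl//; exact: sub_Co.
rewrite ltNge (minimal_polynomial_Rintegral_le A_ge0 _ _ P_min)//.
- exact: lt_trans p_gt1.
- exact: leq_trans (size_scale_leq _ _) sQ.
- move=> j k kj Ajk; rewrite derivnZ hornerZ.
  have /rootP -> : root Q^`(k) (c j); last by rewrite mulr0.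
  by apply: QC; apply/active_nodesP; exists j.
Qed.
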